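(* Let $n>2$ be an integer, let $k$ be an odd integer with $1<k<2^{n}$, and let $r$ be the non-negative integer with $2^r<k<2^{r+1}$. Then $P_{k}(n)=\langle\{k2^{n+i}+1\mid i=0,1,\dots,n+r\}\rangle$.
   Context: $\mathbb{N}$ denotes the set of non-negative integers. For $A\subseteq\mathbb{N}$, $\langle A\rangle$ denotes the set of all finite $\mathbb{N}$-linear combinations of elements of $A$. $P_k(n)=\langle\{k2^{n+i}+1\mid i\in\mathbb{N}\}\rangle$ (the Proth numerical semigroup). *)

(* Defs.v *)
From mathcomp Require Import all_boot.
From mathcomp Require Import boolp classical_sets.

Set Implicit Arguments.
Unset Strict Implicit.
Unset Printing Implicit Defensive.

Local Open Scope classical_set_scope.

(* A finite linear combination is a list of (coefficient, generator) pairs;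
   repeated generators and zero coefficients are allowed. *)
Definition nspan (A : set nat) : set nat :=
  [set x | exists s : seq (nat * nat),
     (forall p, p \in s -> A p.2) /\ x = \sum_(p <- s) p.1 * p.2].

Definition proth (k n : nat) : set nat :=
  nspan [set k * 2 ^ (n + i) + 1 | i in [set: nat]].

(* Main.v *)
Require Import Defs.
From mathcomp Require Import all_boot.
From mathcomp Require Import boolp classical_sets.
From mathcomp Require Import zify.

(** Write [s_i = k 2^(n+i) + 1], so that [s_(i+1) = 2 s_i - 1], and let [S] be
    generated by [s_0, ..., s_(n+r)].  A sum of [N] generators whose powers
    [2^i] add up to [M] equals [k 2^n M + N].  Since
    [s_(n+r+1) = k 2^n (2^(n+r+1) - 1) + (k 2^n + 1)], it lies in [S] as soon as
    [2^(n+r+1) - 1] is a sum of exactly [k 2^n + 1] powers [2^i], [i <= n+r];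
    this holds for any number of summands between [n+r+1] and [2^(n+r+1) - 1].
    Then [S] is stable under [x |-> 2 x - 1] on its positive elements, hence
    contains every [s_i]. *)

Local Open Scope classical_set_scope.

Section Nspan.
Implicit Types A B : set nat.

Lemma nspan0 A : nspan A 0.
Proof. by exists [::]; split=> //; rewrite big_nil. Qed.

Lemma nspan_gen A a : A a -> nspan A a.
Proof.
move=> Aa; exists [:: (1, a)]; split; last by rewrite big_seq1 mul1n.
by move=> p; rewrite inE => /eqP ->.
Qed.

Lemma nspanD A x y : nspan A x -> nspan A y -> nspan A (x + y).
Proof.
move=> [s [sA ->]] [t [tA ->]]; exists (s ++ t); split; last by rewrite big_cat.
by move=> p; rewrite mem_cat => /orP[/sA|/tA].
Qed.

Lemma nspan_ind A (P : nat -> Prop) :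
    P 0 -> (forall a x, A a -> nspan A x -> P x -> P (a + x)) ->
  forall x, nspan A x -> P x.
Proof.
move=> P0 PD x [s [sA ->]]; suff [] :
  nspan A (\sum_(p <- s) p.1 * p.2) /\ P (\sum_(p <- s) p.1 * p.2) by [].
elim: s sA => [|[c a] s IHs] sA; first by rewrite big_nil; split=> //; exact: nspan0.
have Aa : A a by apply: (sA (c, a)); rewrite inE eqxx.
have [|Ss Ps] := IHs; first by move=> p ps; apply: sA; rewrite inE ps orbT.
rewrite big_cons /=; elim: c {sA} => [|c [Sc Pc]]; first by rewrite mul0n.
rewrite mulSn -addnA; split; last exact: PD.
by apply: nspanD => //; exact: nspan_gen.
Qed.

Lemma nspan_min A B : A `<=` nspan B -> nspan A `<=` nspan B.
Proof.
move=> AB; apply: nspan_ind; first exact: nspan0.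
by move=> a x /AB Ba _; exact: nspanD.
Qed.

Lemma nspanS A B : A `<=` B -> nspan A `<=` nspan B.
Proof. by move=> AB; apply: nspan_min => a /AB; exact: nspan_gen. Qed.

(* With truncated subtraction the case [x = 0] is harmless. *)
Lemma nspan_double_pred A :
    (forall a, A a -> 0 < a /\ nspan A (2 * a - 1)) ->
  forall x, nspan A x -> nspan A (2 * x - 1).
Proof.
move=> dA; apply: nspan_ind; first exact: nspan0.
move=> a x /dA[a_gt0 Sa] Sx _.
(* A single generator absorbs the [- 1]; the rest is merely doubled. *)
have -> : 2 * (a + x) - 1 = (2 * a - 1) + (x + x) by lia.
by do 2!apply: nspanD => //.
Qed.

End Nspan.

Section TruncatedGenerators.
Variable q : nat.

(** Here [q] stands for [k * 2 ^ n]. *)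
Let gens m : set nat := [set q * 2 ^ i + 1 | i in [set i : nat | i <= m]].

Lemma nspan_gensS m : nspan (gens m) `<=` nspan (gens m.+1).
Proof. by apply: nspanS => _ [i /= im <-]; exists i => //=; exact: leqW. Qed.

(** Halve [2 ^ m] and share the [j] summands between the halves, until a share is 1. *)
Lemma nspan_gens_pow2 m j :
  0 < j <= 2 ^ m -> nspan (gens m) (q * 2 ^ m + j).
Proof.
elim: m j => [|m IHm] j jm.
  by apply: nspan_gen; exists 0 => //; rewrite expn0 in jm *; lia.
have [->|j_gt1] : j = 1 \/ 1 < j by lia.
  by apply: nspan_gen; exists m.+1 => /=.
rewrite expnS in jm *.
have -> : q * (2 * 2 ^ m) + j = (q * 2 ^ m + j./2) + (q * 2 ^ m + (j - j./2)).
  by lia.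
by apply: nspanD; apply/nspan_gensS/IHm; lia.
Qed.

(* Induction on [m]: [2^(m+1) - 1 = 2^m + (2^m - 1)], where [2^m] is left whole
   while [N <= 2^m], and otherwise [2^m - 1] is split into ones. *)
Lemma nspan_gens_pow2_pred m N :
  m < N < 2 ^ m.+1 -> nspan (gens m) (q * (2 ^ m.+1 - 1) + N).
Proof.
elim: m N => [|m IHm] N.
  rewrite expn1 => N1; apply: nspan_gen; exists 0 => //; rewrite expn0; lia.
have ltm := ltn_expl m.+1 (isT : 1 < 2).
rewrite (expnS _ m.+1) => Nm.
(* [j] summands make up [2 ^ m.+1], the other [N - j] make up [2 ^ m.+1 - 1]. *)
have split_at j : 0 < j <= 2 ^ m.+1 -> m < N - j < 2 ^ m.+1 -> j <= N ->
    nspan (gens m.+1) (q * (2 * 2 ^ m.+1 - 1) + N).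
  move=> j1 j2 jN.
  have -> : q * (2 * 2 ^ m.+1 - 1) + N
          = (q * 2 ^ m.+1 + j) + (q * (2 ^ m.+1 - 1) + (N - j)).
    have -> : 2 * 2 ^ m.+1 - 1 = 2 ^ m.+1 + (2 ^ m.+1 - 1) by lia.
    by rewrite mulnDr; lia.
  by apply: nspanD; [exact: nspan_gens_pow2 | exact/nspan_gensS/IHm].
have [Nle|Ngt] := leqP N (2 ^ m.+1); first by apply: (split_at 1); lia.
by apply: (split_at (N - (2 ^ m.+1 - 1))); lia.
Qed.

(** The bounds make [q.+1] an admissible number of summands for [2 ^ m.+1 - 1]; this handles the
    successor of the last generator. *)
Lemma nspan_gens_all m :
  m <= q -> q.+1 < 2 ^ m.+1 -> forall i, nspan (gens m) (q * 2 ^ i + 1).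
Proof.
move=> mq qm; have dbl i : 2 * (q * 2 ^ i + 1) - 1 = q * 2 ^ i.+1 + 1.
  by rewrite expnS; lia.
elim=> [|i IHi]; first by apply: nspan_gen; exists 0.
rewrite -dbl; apply: nspan_double_pred => // _ [j /= jm <-]; split; first by lia.
rewrite dbl; have [->|ltjm] : j = m \/ j < m by lia.
  have -> : q * 2 ^ m.+1 + 1 = q * (2 ^ m.+1 - 1) + q.+1.
    by rewrite mulnBr muln1; have := leq_pmulr q (expn_gt0 2 m.+1); lia.
  by apply: nspan_gens_pow2_pred; lia.
by apply: nspan_gen; exists j.+1.
Qed.

End TruncatedGenerators.

Theorem theorem3 (n k r : nat) (hn : 2 < n) (kodd : odd k)
  (hk1 : 1 < k) (hkn : k < 2 ^ n) (hr1 : 2 ^ r < k) (hr2 : k < 2 ^ r.+1) :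
  proth k n =
    nspan [set k * 2 ^ (n + i) + 1 | i in [set i : nat | i <= n + r]].
Proof.
have genE : (fun i => k * 2 ^ (n + i) + 1) = (fun i => k * 2 ^ n * 2 ^ i + 1).
  by apply: funext => i; rewrite expnD mulnA.
rewrite /proth genE eqEsubset; split; last by apply: nspanS => _ [i _ <-]; exists i.
apply: nspan_min => _ [i _ <-]; apply: nspan_gens_all.
  have := ltn_expl (n + r) (isT : 1 < 2); rewrite expnD.
  have : 2 ^ n * 2 ^ r <= k * 2 ^ n by rewrite mulnC leq_mul2r ltnW ?orbT.
  by lia.
(* Since [k.+1 <= 2 ^ r.+1], there is a slack of [2 ^ n], which exceeds the 1 in [q.+1]. *)
have : k.+1 * 2 ^ n <= 2 ^ r.+1 * 2 ^ n by rewrite leq_mul2r hr2 orbT.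
rewrite -addnS expnD mulSn; have : 2 ^ 2 <= 2 ^ n by rewrite leq_exp2l // ltnW.
by lia.
Qed.
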